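(* Let $(\mathfrak g,\mathcal F_\bullet\mathfrak g,R)$ be a filtered Rota–Baxter Lie algebra over a field $\mathbf k$ of characteristic zero, and let $\widehat{\mathfrak g}$, $\widehat U(\mathfrak g)$, $\mathbb G$, $\exp$, $\log$, $*$ and $\widehat{\mathcal R}$ be as described in the context. Then the map $\mathfrak R:\widehat{\mathfrak g}\to\widehat{\mathfrak g}$ defined by $$\mathfrak R(x)=\log\big(\widehat{\mathcal R}(\exp(x))\big),\qquad x\in\widehat{\mathfrak g},$$ is a Rota–Baxter operator on the group $(\widehat{\mathfrak g},* )$, i.e. $\mathfrak R(x)*\mathfrak R(y)=\mathfrak R\big(x*\mathfrak R(x)*y*\mathfrak R(x)^{-1}\big)$ for all $x,y\in\widehat{\mathfrak g}$ (inverse taken in $(\widehat{\mathfrak g},* )$). In particular, if $(\mathfrak g,\mathcal F_\bullet\mathfrak g,R)$ is a complete Rota–Baxter Lie algebra (so $\mathfrak g\cong\widehat{\mathfrak g}$), then $(\mathfrak g,*,\mathfrak R)$, with $\mathfrak R$ defined by the same formula for all $x\in\mathfrak g$, is a Rota–Baxter group.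
   Context: A filtered Lie algebra $(\mathfrak g,\mathcal F_\bullet\mathfrak g)$ is a Lie algebra $\mathfrak g$ with subspaces $\mathfrak g=\mathcal F_1\mathfrak g\supset\mathcal F_2\mathfrak g\supset\cdots$ such that $[\mathcal F_n\mathfrak g,\mathcal F_m\mathfrak g]\subset\mathcal F_{n+m}\mathfrak g$ for all $n,m\ge1$. A Rota–Baxter operator (of weight 1) on a Lie algebra is a linear map $R$ with $[R(x),R(y)]=R([R(x),y]+[x,R(y)]+[x,y])$. A filtered Rota–Baxter Lie algebra $(\mathfrak g,\mathcal F_\bullet\mathfrak g,R)$ is a filtered Lie algebra with a Rota–Baxter operator $R$ satisfying $R(\mathcal F_n\mathfrak g)\subset\mathcal F_n\mathfrak g$ for all $n\ge1$; it is complete if the natural map $\mathfrak g\to\varprojlim_n\mathfrak g/\mathcal F_{n+1}\mathfrak g$ is bijective. A Rota–Baxter group is a group $G$ with a map $\mathfrak R:G\to G$ satisfying $\mathfrak R(g)\mathfrak R(h)=\mathfrak R(g\mathfrak R(g)h\mathfrak R(g)^{-1})$ for all $g,h\in G$. The filtered universal enveloping algebra: $\mathcal F_0U(\mathfrak g)=U(\mathfrak g)$ and, for $n\ge1$, $\mathcal F_nU(\mathfrak g)$ is the span of products $x_1\cdots x_k$ with $k\ge1$, $x_i\in\mathcal F_{n_i}\mathfrak g$, $\sum_i n_i\ge n$. Let $\mathcal R:U(\mathfrak g)\to U(\mathfrak g)$ be the (well-defined) linear map determined by $\mathcal R(1)=1$, $\mathcal R(x)=R(x)$ and $\mathcal R(xh)=R(x)\mathcal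 R(h)-\mathcal R([R(x),h])$ for $x\in\mathfrak g$, $h\in U(\mathfrak g)$. It satisfies $\mathcal R(\mathcal F_nU(\mathfrak g))\subset\mathcal F_nU(\mathfrak g)$ for all $n$, hence induces a map $\widehat{\mathcal R}$ on the completion $\widehat U(\mathfrak g)=\varprojlim_n U(\mathfrak g)/\mathcal F_{n}U(\mathfrak g)$ (acting componentwise). $\widehat U(\mathfrak g)$ is a complete Hopf algebra whose operations are induced from those of $U(\mathfrak g)$; its coproduct $\widehat\Delta$ takes values in the completion $\widehat U(\mathfrak g)\hat\otimes\widehat U(\mathfrak g)$ of $U(\mathfrak g)\otimes U(\mathfrak g)$ with respect to the filtration $\mathcal F_n(U\otimes U)=\sum_{i+j=n}\mathcal F_iU\otimes\mathcal F_jU$. The completion $\widehat{\mathfrak g}=\varprojlim_n\mathfrak g/\mathcal F_{n+1}\mathfrak g$ is regarded as a subspace of $\mathcal F_1\widehat U(\mathfrak g)=\ker\big(\widehat U(\mathfrak g)\to U(\mathfrak g)/\mathcal F_1U(\mathfrak g)\big)$. For $x\in\mathcal F_1\widehat U(\mathfrak g)$, $\exp(x)=\sum_{n\ge0}x^n/n!$ (convergent). $\mathbb G$ denotes the group of nonzero $g\in\widehat U(\mathfrak g)$ with $\widehat\Delta(g)=g\hat\otimes g$; the map $\exp:\widehat{\mathfrak g}\to\mathbb G$ is a bijection with inverse $\log$, and $x*y=\log(\exp(x)\exp(y))$ (the Baker–Campbell–Hausdorff product) is a group structure on $\widehat{\mathfrak g}$ making $\exp$ a group isomorphism. Moreover $\widehat{\mathcal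 R}(\mathbb G)\subset\mathbb G$. *)

(* Defs.v *)
From HB Require Import structures.
From mathcomp Require Import all_boot all_order all_algebra.
Set Implicit Arguments. Unset Strict Implicit. Unset Printing Implicit Defensive.
Import Order.TTheory GRing.Theory Num.Theory.
Local Open Scope ring_scope.

Section Defs.
Variable K : fieldType.

Definition is_lie (V : lmodType K) (br : V -> V -> V) : Prop :=
  [/\ forall a x y z, br (a *: x + y) z = a *: br x z + br y z,
      forall a x y z, br z (a *: x + y) = a *: br z x + br z y,
      forall x, br x x = 0 &
      forall x y z, br x (br y z) + br y (br z x) + br z (br x y) = 0].

(* F n (n >= 1) is a descending filtration of the Lie algebra by subspaces,
   F 1 = whole space, [F n, F m] <= F (n+m).  The value F 0 is unused. *)
Definition is_lie_filtration (V : lmodType K) (br : V -> V -> V)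
    (F : nat -> V -> Prop) : Prop :=
  [/\ forall n, (1 <= n)%N -> F n 0,
      forall n a x y, (1 <= n)%N -> F n x -> F n y -> F n (a *: x + y),
      forall x, F 1%N x,
      forall n x, (1 <= n)%N -> F n.+1 x -> F n x &
      forall n m x y, (1 <= n)%N -> (1 <= m)%N -> F n x -> F m y ->
        F (n + m)%N (br x y)].

Definition is_rota_baxter_lie (V : lmodType K) (br : V -> V -> V)
    (R : V -> V) : Prop :=
  forall x y, br (R x) (R y) = R (br (R x) y + br x (R y) + br x y).

Definition filtered_rb_lie (V : lmodType K) (br : V -> V -> V)
    (F : nat -> V -> Prop) (R : {linear V -> V}) : Prop :=
  [/\ is_lie br, is_lie_filtration br F, is_rota_baxter_lie br R &
      forall n x, (1 <= n)%N -> F n x -> F n (R x)].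

(* Complete: g -> lim_n g / F_{n+1} g is bijective. *)
(* an element of the inverse limit: xs m is a representative in g / F_m g *)
Definition gseq (V : lmodType K) (F : nat -> V -> Prop) (xs : nat -> V) : Prop :=
  forall m, (1 <= m)%N -> F m (xs m.+1 - xs m).
Definition geq (V : lmodType K) (F : nat -> V -> Prop) (xs ys : nat -> V) : Prop :=
  forall m, (1 <= m)%N -> F m (xs m - ys m).
Definition complete_filtration (V : lmodType K) (F : nat -> V -> Prop) : Prop :=
  (forall x y : V, geq F (fun=> x) (fun=> y) -> x = y) /\
  (forall xs, gseq F xs -> exists x : V, geq F (fun=> x) xs).

Definition lie_hom (V : lmodType K) (br : V -> V -> V) (B : algType K)
    (f : V -> B) : Prop :=
  linear f /\ forall x y, f (br x y) = f x * f y - f y * f x.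

Definition alg_hom (A B : algType K) (phi : A -> B) : Prop :=
  [/\ linear phi, phi 1 = 1 & forall u v, phi (u * v) = phi u * phi v].

Definition is_UEA (V : lmodType K) (br : V -> V -> V) (A : algType K)
    (i : V -> A) : Prop :=
  lie_hom br i /\
  forall (B : algType K) (f : V -> B), lie_hom br f ->
    exists phi : A -> B,
      [/\ alg_hom phi, forall x, phi (i x) = f x &
          forall psi : A -> B, alg_hom psi -> (forall x, psi (i x) = f x) ->
            forall u, psi u = phi u].

(* Filtration of U(g): F_0 U = U; for n >= 1, F_n U is the span of products
   i x_1 * ... * i x_k (k >= 1) with x_j in F_{n_j} g, n_j >= 1, sum n_j >= n. *)
Definition FU (V : lmodType K) (F : nat -> V -> Prop) (A : algType K)
    (i : V -> A) (n : nat) (u : A) : Prop :=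
  if n is 0%N then True else
  exists ws : seq (K * seq (nat * V)),
    [/\ u = \sum_(w <- ws) w.1 *: \prod_(p <- w.2) i p.2,
        forall w, w \in ws -> w.2 != [::] /\ (n <= \sum_(p <- w.2) p.1)%N &
        forall w p, w \in ws -> p \in w.2 -> (1 <= p.1)%N /\ F p.1 p.2].

(* An element of hat U = lim_n U / F_n U is represented by u : nat -> A,
   u n being a representative of the component in U / F_n U. *)
Variables (V : lmodType K) (F : nat -> V -> Prop) (A : algType K) (i : V -> A).

Definition useq (u : nat -> A) : Prop := forall n, FU F i n (u n.+1 - u n).
Definition ueq (u v : nat -> A) : Prop := forall n, FU F i n (u n - v n).

Definition embed (xs : nat -> V) : nat -> A := fun n => i (xs n).

Definition in_ghat (u : nat -> A) : Prop :=
  exists xs, gseq F xs /\ ueq u (embed xs).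

Definition umul (u v : nat -> A) : nat -> A := fun n => u n * v n.
Definition uopp (u : nat -> A) : nat -> A := fun n => - u n.

(* exp (for arguments in F_1 hat U) and log (for arguments in 1 + F_1 hat U) *)
Definition uexp (u : nat -> A) : nat -> A :=
  fun n => \sum_(k < n) ((k`!)%:R^-1 : K) *: (u n) ^+ k.
Definition ulog (u : nat -> A) : nat -> A :=
  fun n => \sum_(1 <= k < n) ((-1) ^+ k.+1 / k%:R : K) *: (u n - 1) ^+ k.

Definition bch (x y : nat -> A) : nat -> A := ulog (umul (uexp x) (uexp y)).

Definition uhat (cR : A -> A) (u : nat -> A) : nat -> A := fun n => cR (u n).

Definition frakR (cR : A -> A) (x : nat -> A) : nat -> A :=
  ulog (uhat cR (uexp x)).

End Defs.

Definition is_calR (K : fieldType) (V : lmodType K) (A : algType K)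
    (i : V -> A) (R : V -> V) (cR : A -> A) : Prop :=
  [/\ linear cR, cR 1 = 1, forall x, cR (i x) = i (R x) &
      forall x h, cR (i x * h) =
        i (R x) * cR h - cR (i (R x) * h - h * i (R x))].

(* Main.v *)
Require Import Defs.
From HB Require Import structures.
From mathcomp Require Import all_boot all_order all_algebra.
From mathcomp Require Import boolp ring.
Import GRing.Theory.
Local Open Scope ring_scope.
Set Implicit Arguments. Unset Strict Implicit. Unset Printing Implicit Defensive.

(* A gseq x in hat g is lifted to a power series f in t over U whose coefficient of
   t^k lies in i(F_k), and the statements are read off by setting t = 1 modulo F_n U.
   In U[[t]], with E = exp f, E' = xi E and g = cR E (coefficientwise), the relation
   cR(y u) = cR(y) cR(u) - cR [cR y, u] for y with coefficients in i(g), together with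
   E y = (e^{ad f} y) E, shows that if b solves b = xi + (e^{ad f} - 1)(cR b) and
   a = cR b, then every w with w' = [a, w] satisfies cR(E w)' = a cR(E w).
   - w = 1 gives g' = a g with a a series of Lie elements; hence Om = log g satisfies
     ((e^{ad Om} - 1) / ad Om)(Om') = a (Magnus), and its coefficients are Lie elements
     by induction.
   - w = g h g^{-1}, h constant in t, gives cR(E g h g^{-1}) = g cR(h), both sides
     solving the same linear ODE with the same constant term.
   Neither the coproduct nor the Poincare-Birkhoff-Witt theorem is involved. *)

(** * Power series over a noncommutative ring *)

Lemma sum_triangle (B : nmodType) (c : nat -> nat -> B) N :
  \sum_(k < N) \sum_(j < k.+1) c j (k - j)%N
  = \sum_(j < N) \sum_(l < N - j) c j l.
Proof.
elim: N => [|N IH]; first by rewrite !big_ord0.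
rewrite big_ord_recr /= IH [RHS]big_ord_recr /= subSnn big_ord1.
rewrite [X in _ + X]big_ord_recr /= subnn addrA -big_split /=; congr (_ + _).
by apply: eq_bigr => j _; rewrite subSn ?big_ord_recr //= ltnW.
Qed.

(** The difference is the sum of the products u_j v_l with j, l < N <= j + l. The predicate [I] will
    be the vanishing of a coefficient, or membership in F_n U. *)
Lemma mul_partial_sums (B : pzRingType) (I : B -> Prop) (u v : nat -> B) N :
  I 0 -> (forall x y, I x -> I y -> I (x + y)) ->
  (forall j l, (N <= j + l)%N -> I (u j * v l)) ->
  I ((\sum_(k < N) u k) * (\sum_(l < N) v l)
     - \sum_(k < N) \sum_(j < k.+1) u j * v (k - j)%N).
Proof.
move=> I0 ID Iuv.
rewrite (sum_triangle (fun j l => u j * v l)) mulr_suml -sumrB.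
elim/big_ind: _ => // j _.
rewrite mulr_sumr -!(big_mkord xpredT (fun l => u j * v l)).
rewrite (big_cat_nat (leq0n (N - j)) (leq_subr j N)) /= addrAC subrr add0r.
rewrite big_nat; elim/big_ind: _ => // l /andP[lel _].
by apply: Iuv; rewrite -leq_subLR.
Qed.

(** The record keeps the Cauchy product apart from pointwise operations on functions. *)
Record pseries (A : Type) := Pseries {pcoef :> nat -> A}.

HB.instance Definition _ (A : Type) := gen_eqMixin (pseries A).
HB.instance Definition _ (A : Type) := gen_choiceMixin (pseries A).

Lemma pseriesP (A : Type) (f g : pseries A) : (forall n, f n = g n) <-> f = g.
Proof.
split=> [|-> //]; case: f g => [f] [g] /= fg.
by congr Pseries; apply/funext.
Qed.

Section PseriesRing.
Variable A : nzRingType.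
Implicit Types f g h : pseries A.

Definition ps_add f g := Pseries (fun n => f n + g n).
Definition ps_opp f := Pseries (fun n => - f n).
Definition ps_const (a : A) := Pseries (fun n => a *+ (n == 0)).
Definition ps_mul f g := Pseries (fun n => \sum_(j < n.+1) f j * g (n - j)%N).
Definition ps_poly n f := \poly_(j < n) f j.

Fact ps_addA : associative ps_add.
Proof. by move=> f g h; apply/pseriesP => n; rewrite /= addrA. Qed.
Fact ps_addC : commutative ps_add.
Proof. by move=> f g; apply/pseriesP => n; rewrite /= addrC. Qed.
Fact ps_add0 : left_id (ps_const 0) ps_add.
Proof. by move=> f; apply/pseriesP => n; rewrite /= mul0rn add0r. Qed.
Fact ps_addN : left_inverse (ps_const 0) ps_opp ps_add.
Proof. by move=> f; apply/pseriesP => n; rewrite /= mul0rn addNr. Qed.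

HB.instance Definition _ :=
  GRing.isZmodule.Build (pseries A) ps_addA ps_addC ps_add0 ps_addN.

(** Coefficients below N can be computed on truncations, so associativity is inherited from
    polynomials. *)
Lemma ps_mul_coef n N f g :
  (n < N)%N -> ps_mul f g n = (ps_poly N f * ps_poly N g)`_n.
Proof.
move=> nN; rewrite coefM /=; apply: eq_bigr => j _; rewrite !coef_poly.
by rewrite (leq_ltn_trans (leq_subr _ _) nN) (leq_ltn_trans _ nN) // -ltnS.
Qed.

Fact ps_mulA : associative ps_mul.
Proof.
move=> f g h; apply/pseriesP => n; pose N := n.+1.
transitivity ((ps_poly N f * (ps_poly N g * ps_poly N h))`_n).
  rewrite coefM; apply: eq_bigr => j _.
  by rewrite coef_poly ltn_ord (ps_mul_coef (N := N)) // ltnS leq_subr.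
rewrite mulrA coefM; apply: eq_bigr => j _.
by rewrite coef_poly ltnS leq_subr (ps_mul_coef (N := N)).
Qed.
Fact ps_mul1 : left_id (ps_const 1) ps_mul.
Proof.
move=> f; apply/pseriesP => n; rewrite /= big_ord_recl /= mul1r subn0.
by rewrite big1 ?addr0 // => j _; rewrite mul0r.
Qed.
Fact ps_mulr1 : right_id (ps_const 1) ps_mul.
Proof.
move=> f; apply/pseriesP => n; rewrite /= big_ord_recr /= subnn mulr1.
by rewrite big1 ?add0r // => j _; rewrite subn_eq0 leqNgt ltn_ord mulr0.
Qed.
Fact ps_mulDl : left_distributive ps_mul ps_add.
Proof.
move=> f g h; apply/pseriesP => n /=; rewrite -big_split.
by apply: eq_bigr => j _; rewrite mulrDl.
Qed.
Fact ps_mulDr : right_distributive ps_mul ps_add.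
Proof.
move=> f g h; apply/pseriesP => n /=; rewrite -big_split.
by apply: eq_bigr => j _; rewrite mulrDr.
Qed.
Fact ps_1neq0 : ps_const 1 != 0.
Proof. by apply/eqP => /pseriesP/(_ 0%N)/eqP; rewrite (negPf (oner_neq0 _)). Qed.

HB.instance Definition _ := GRing.Zmodule_isNzRing.Build (pseries A)
  ps_mulA ps_mul1 ps_mulr1 ps_mulDl ps_mulDr ps_1neq0.

Lemma psM f g n : (f * g) n = \sum_(j < n.+1) f j * g (n - j)%N.
Proof. by []. Qed.
Lemma ps1 n : (1 : pseries A) n = (n == 0)%:R. Proof. by []. Qed.

Lemma psD f g n : (f + g) n = f n + g n. Proof. by []. Qed.
Lemma psB f g n : (f - g) n = f n - g n. Proof. by []. Qed.
Lemma psN f n : (- f) n = - f n. Proof. by []. Qed.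
Lemma ps0 n : (0 : pseries A) n = 0. Proof. exact: mul0rn. Qed.
Lemma ps_sum (I : Type) (r : seq I) P (F : I -> pseries A) n :
  (\sum_(k <- r | P k) F k) n = \sum_(k <- r | P k) F k n.
Proof. by elim/big_ind2: _ => [|x y z t <- <-|//] //; rewrite ps0. Qed.

End PseriesRing.

Section PseriesAlg.
Variables (K : comNzRingType) (A : algType K).
Implicit Types f g h : pseries A.
Definition ps_scale (a : K) f := Pseries (fun n => a *: f n).
Fact ps_scaleA a b f : ps_scale a (ps_scale b f) = ps_scale (a * b) f.
Proof. by apply/pseriesP => n /=; rewrite scalerA. Qed.
Fact ps_scale1 : left_id 1 ps_scale.
Proof. by move=> f; apply/pseriesP => n /=; rewrite scale1r. Qed.
Fact ps_scaleDr : right_distributive ps_scale +%R.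
Proof. by move=> a f g; apply/pseriesP => n /=; rewrite scalerDr. Qed.
Fact ps_scaleDl f : {morph ps_scale^~ f : a b / a + b}.
Proof. by move=> a b; apply/pseriesP => n /=; rewrite scalerDl. Qed.
HB.instance Definition _ := GRing.Zmodule_isLmodule.Build K (pseries A)
  ps_scaleA ps_scale1 ps_scaleDr ps_scaleDl.
Lemma psZ a f n : (a *: f) n = a *: f n. Proof. by []. Qed.
Fact ps_scaleAl a f g : a *: (f * g) = a *: f * g.
Proof.
apply/pseriesP => n; rewrite psZ !psM scaler_sumr.
by apply: eq_bigr => j _; rewrite scalerAl.
Qed.
HB.instance Definition _ := GRing.Lmodule_isLalgebra.Build K (pseries A) ps_scaleAl.
Fact ps_scaleAr a f g : a *: (f * g) = f * (a *: g).
Proof.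
apply/pseriesP => n; rewrite psZ !psM scaler_sumr.
by apply: eq_bigr => j _; rewrite scalerAr.
Qed.
HB.instance Definition _ := GRing.Lalgebra_isAlgebra.Build K (pseries A) ps_scaleAr.
End PseriesAlg.

(** * Derivation, t-adic order and summable families *)

Section DerivSum.
Variable A : nzRingType.
Implicit Types f g h : pseries A.

Definition ps_deriv f := Pseries (fun n => f n.+1 *+ n.+1).

Lemma ps_derivM f g : ps_deriv (f * g) = ps_deriv f * g + f * ps_deriv g.
Proof.
have dE N h : ps_poly N (ps_deriv h) = (ps_poly N.+1 h)^`().
  by apply/polyP => n; rewrite coef_deriv !coef_poly ltnS; case: ifP; rewrite ?mul0rn.
have MC (p q p' q' : {poly A}) n : (forall k, (k <= n)%N -> p`_k = p'`_k) ->
    (forall k, (k <= n)%N -> q`_k = q'`_k) -> (p * q)`_n = (p' * q')`_n.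
  move=> pp qq; rewrite !coefM; apply: eq_bigr => j _.
  by rewrite pp ?qq ?leq_subr // -ltnS.
apply/pseriesP => n; rewrite psD.
(* Leibniz's rule is inherited from polynomials; coefficient n of a derivative reads coefficient n +
   1, hence the truncation at [n.+2]. *)
have -> : ps_deriv (f * g) n = ((ps_poly n.+2 f * ps_poly n.+2 g)^`())`_n.
  by rewrite coef_deriv -ps_mul_coef.
rewrite derivM coefD -!dE; congr (_ + _).
  rewrite (ps_mul_coef (ps_deriv f) g (ltnSn n)); apply: MC => k kn //.
  by rewrite !coef_poly !ltnS kn leqW.
rewrite (ps_mul_coef f (ps_deriv g) (ltnSn n)); apply: MC => k kn //.
by rewrite !coef_poly !ltnS kn leqW.
Qed.

(** This is membership in t^k A[[t]]. *)
Definition ord_ge k f := forall j, (j < k)%N -> f j = 0.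

Lemma ord_geM k l f g : ord_ge k f -> ord_ge l g -> ord_ge (k + l) (f * g).
Proof.
move=> fk gl n nkl; rewrite psM big1 // => j _.
have [jk|kj] := ltnP j k; first by rewrite fk ?mul0r.
rewrite gl ?mulr0 // -(ltn_add2l j) subnKC -1?ltnS //.
by apply: leq_trans nkl _; rewrite leq_add2r.
Qed.

Lemma ord_geB k f g : ord_ge k f -> ord_ge k g -> ord_ge k (f - g).
Proof. by move=> fk gk j jk; rewrite psB fk ?gk ?subr0. Qed.

Lemma ord_geX k f : ord_ge 1 f -> ord_ge k (f ^+ k).
Proof. by move=> f1; elim: k => [//|k IH]; rewrite exprS -add1n; apply: ord_geM. Qed.

Definition ad (B : pzRingType) (f y : B) := f * y - y * f.

Lemma ord_ge_ad k l f g : ord_ge k f -> ord_ge l g -> ord_ge (k + l) (ad f g).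
Proof.
by move=> fk gl; apply: ord_geB; last rewrite addnC; apply: ord_geM.
Qed.

Lemma ord_ge_iter_ad k l f y : ord_ge 1 f -> ord_ge l y -> ord_ge (k + l) (iter k (ad f) y).
Proof.
by move=> f1 yl; elim: k => [//|k IH]; rewrite iterS addSn -add1n; apply: ord_ge_ad.
Qed.

(** For a [summable] family, u_k lies in t^k A[[t]], so stopping at k = n loses nothing in
    coefficient n. *)
Definition psum (u : nat -> pseries A) := Pseries (fun n => \sum_(k < n.+1) u k n).
Definition summable (u : nat -> pseries A) := forall k, ord_ge k (u k).

Lemma psumE u N n : summable u -> (n < N)%N -> psum u n = (\sum_(k < N) u k) n.
Proof.
move=> su nN; rewrite ps_sum /= -!(big_mkord xpredT (fun k => u k n)).
rewrite (big_cat_nat (leq0n n.+1) nN) /= [X in _ + X]big_nat [X in _ + X]big1 ?addr0 // => k /andP[nk _].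
exact: su.
Qed.

Lemma eq_psum u v : (forall k, u k = v k) -> psum u = psum v.
Proof. by move=> uv; apply/pseriesP => n /=; apply: eq_bigr => k _; rewrite uv. Qed.

Lemma ps_mul_local n f g f' g' : (forall k, (k <= n)%N -> f k = f' k) ->
  (forall k, (k <= n)%N -> g k = g' k) -> (f * g) n = (f' * g') n.
Proof.
move=> pp qq; rewrite !psM; apply: eq_bigr => j _.
by rewrite pp ?qq ?leq_subr // -ltnS.
Qed.

(** Products u_j v_l with j + l > n do not reach coefficient n, so finite partial sums suffice. *)
Lemma psumM u v : summable u -> summable v ->
  psum u * psum v = psum (fun k => \sum_(j < k.+1) u j * v (k - j)%N).
Proof.
move=> su sv; apply/pseriesP => n.
rewrite (@ps_mul_local n _ _ (\sum_(k < n.+1) u k) (\sum_(k < n.+1) v k)); first last.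
- by move=> k kn; apply: psumE.
- by move=> k kn; apply: psumE.
rewrite [RHS]/= -ps_sum; apply/eqP; rewrite -subr_eq0 -psB; apply/eqP.
apply: (mul_partial_sums (I := fun f : pseries A => f n = 0)).
- exact: ps0.
- by move=> x y xn yn; rewrite psD xn yn addr0.
- by move=> j l njl; apply: (ord_geM (su j) (sv l)).
Qed.

Lemma psumMr u y : summable u -> psum u * y = psum (fun k => u k * y).
Proof.
move=> su; apply/pseriesP => n.
rewrite (@ps_mul_local n _ _ (\sum_(k < n.+1) u k) y) //.
  by rewrite mulr_suml ps_sum.
by move=> k kn; apply: psumE.
Qed.

Lemma ps_deriv_psum u : summable u -> u 0 = 1 ->
  ps_deriv (psum u) = psum (fun k => ps_deriv (u k.+1)).
Proof.
move=> su u0; apply/pseriesP => n /=.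
by rewrite big_ord_recl /= u0 ps1 add0r -sumrMnl.
Qed.

End DerivSum.

(** * Powers and iterated commutators *)

Section AdPowers.
Variable B : pzRingType.
Implicit Types f y : B.
(** Left multiplication by f is the sum of [ad f] and right multiplication by f, which commute; this
    is their binomial formula. *)
Lemma expr_mul_ad f y k : f ^+ k * y =
  \sum_(m < k.+1) iter m (ad f) y * f ^+ (k - m) *+ 'C(k, m).
Proof.
elim: k => [|k IH]; first by rewrite big_ord1 mulr1 mul1r.
have step (m : 'I_k.+1) : f * (iter m (ad f) y * f ^+ (k - m) *+ 'C(k, m)) =
    iter m.+1 (ad f) y * f ^+ (k - m) *+ 'C(k, m) +
    iter m (ad f) y * f ^+ (k.+1 - m) *+ 'C(k, m).
  rewrite mulrnAr -mulrnDl iterS /ad mulrBl subSn -1?ltnS // exprS !mulrA.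
  by rewrite addrNK.
rewrite exprS -mulrA IH mulr_sumr (eq_bigr _ (fun m _ => step m)) big_split /=.
rewrite [RHS]big_ord_recl /= [X in _ + X]big_ord_recl /= !bin0 addrCA; congr (_ + _).
under [RHS]eq_bigr => m _ do rewrite /bump /= add1n binS mulrnDr subSS addrC.
rewrite big_split /=; congr (_ + _).
rewrite [RHS]big_ord_recr /= bin_small // mulr0n addr0.
by apply: eq_bigr => m _; rewrite /bump /= add1n subSS.
Qed.
End AdPowers.

(** Induction on k: the derivative of f^(k+1) is f' f^k + f (f^k)'. Moving the left factor f past an
    iterated commutator produces one more [ad f], and Pascal's rule collects the coefficients. *)
Lemma ps_deriv_expr (A : nzRingType) (f : pseries A) k : ps_deriv (f ^+ k) =
  \sum_(m < k) iter m (ad f) (ps_deriv f) * f ^+ (k.-1 - m) *+ 'C(k, m.+1).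
Proof.
elim: k => [|k IH].
  by rewrite big_ord0; apply/pseriesP => n /=; rewrite !mul0rn.
set y := ps_deriv f in IH *.
have step (m : 'I_k) : f * (iter m (ad f) y * f ^+ (k.-1 - m) *+ 'C(k, m.+1)) =
    iter m.+1 (ad f) y * f ^+ (k - m.+1) *+ 'C(k, m.+1) +
    iter m (ad f) y * f ^+ (k - m) *+ 'C(k, m.+1).
  have km : (k.-1 - m)%N = (k - m.+1)%N by rewrite -subn1 -subnDA.
  rewrite km mulrnAr -mulrnDl iterS /ad mulrBl -(subnSK (ltn_ord m)) exprS !mulrA.
  by rewrite addrNK.
rewrite exprS ps_derivM IH mulr_sumr (eq_bigr _ (fun m _ => step m)) big_split /=.
under [RHS]eq_bigr => m _ do rewrite binS mulrnDr.
rewrite [RHS]big_split /= [X in _ = X + _]big_ord_recr /= bin_small // mulr0n addr0.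
rewrite [X in _ = _ + X]big_ord_recl /= bin0 subn0 mulr1n.
under [X in _ = _ + (_ + X)]eq_bigr => m _ do rewrite /bump /= add1n.
by rewrite addrCA [LHS]addrC -addrA addrC -addrA; congr (_ + _); rewrite addrC.
Qed.

(** * Generation of the enveloping algebra by the Lie algebra *)

Section UEAInduction.
Variables (K : fieldType) (V : lmodType K) (br : V -> V -> V).
Variables (A : algType K) (i : V -> A) (P : A -> Prop).
Hypotheses (P1 : P 1) (PL : forall a x y, P x -> P y -> P (a *: x + y)).
Hypotheses (PM : forall x y, P x -> P y -> P (x * y)).

Let S : {pred A} := fun u => `[< P u >].
Let S_closed : GRing.subsemialg_closed S.
Proof.
have lin : GRing.linear_closed S.
  by move=> a x y /asboolP Px /asboolP Py; apply/asboolP/PL.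
have S1 : 1 \in S by apply/asboolP.
split=> //.
- have S0 : 0 \in S by rewrite -(subrr 1) -scaleN1r addrC lin.
  by split=> // x y Sx Sy; rewrite -[x]scale1r lin.
- have S0 : 0 \in S by rewrite -(subrr 1) -scaleN1r addrC lin.
  by move=> a x Sx; rewrite -[_ *: _]addr0 lin.
- by move=> x y /asboolP Px /asboolP Py; apply/asboolP/PM.
Qed.

Definition uea_sub := {u : A | S u}.
HB.instance Definition _ := SubChoice.on uea_sub.
Let T := uea_sub.
HB.instance Definition _ := GRing.SubChoice_isSubAlgebra.Build K A S uea_sub S_closed.

(** The elements satisfying [P] form a subalgebra [T] containing the image of [i]. The universal
    property yields [phi : A -> T], and [val] after [phi] is the identity by uniqueness. *)
Lemma UEA_ind : is_UEA br i -> (forall x, P (i x)) -> forall u, P u.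
Proof.
move=> [[ilin ibr] univ] Pi u.
pose j x : T := exist _ (i x) (asboolT (Pi x)).
have jhom : lie_hom br j.
  split=> [a x y|x y]; apply: val_inj; [exact: ilin | exact: ibr].
have [phi [[plin p1 pM] pj _]] := univ _ _ jhom.
have [psi [_ _ uniq]] := univ A i (conj ilin ibr).
have -> : u = val (phi u).
  rewrite [LHS](uniq id) ?[RHS](uniq (fun u => val (phi u))) //.
  - by split=> [a x y||x y]; rewrite ?plin ?p1 ?pM.
  - by move=> x; rewrite pj.
by apply/asboolP; exact: (valP (phi u)).
Qed.
End UEAInduction.

(** * Exponential and logarithm in characteristic zero *)

Section ExpLog.
Variables (K : fieldType) (charK0 : [pchar K] =i pred0).

Lemma natf0_neq0 n : (0 < n)%N -> n%:R != 0 :> K.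
Proof. by move=> n0; rewrite ((pcharf0P K).1 charK0) -lt0n. Qed.

(** Level n of [uexp u] is [texp n (u n)]. *)
Definition texp (B : algType K) n (v : B) := \sum_(k < n) (k`!%:R^-1 : K) *: v ^+ k.
(* The term k = 0 vanishes because 1 / 0 = 0. *)
Definition tlog (B : algType K) n (v : B) :=
  \sum_(k < n) ((-1) ^+ k.+1 / k%:R : K) *: v ^+ k.

Lemma scale_nat_invfact (B : lmodType K) n (x : B) :
  (n.+1`!%:R^-1 : K) *: x *+ n.+1 = (n`!%:R^-1 : K) *: x.
Proof.
rewrite -scaler_nat scalerA factS natrM invfM mulrA divff ?mul1r //.
exact: natf0_neq0.
Qed.

Lemma deriv_texp n (p : {poly K}) :
  (texp n.+1 p)^`() = p^`() * (texp n.+1 p - (n`!%:R^-1 : K) *: p ^+ n).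
Proof.
rewrite /texp [in RHS]big_ord_recr /= addrK mulr_sumr raddf_sum big_ord_recl /=.
rewrite expr0 derivZ -polyC1 derivC scaler0 add0r; apply: eq_bigr => k _.
rewrite derivZ deriv_exp /= -scalerMnr scale_nat_invfact scalerAr //.
Qed.

Lemma deriv_tlogX n :
  (1 + 'X) * (tlog n.+1 'X : {poly K})^`() = 1 - (- 'X) ^+ n.
Proof.
have -> : (tlog n.+1 'X : {poly K})^`() = \sum_(k < n) (- 'X) ^+ k.
  rewrite /tlog raddf_sum big_ord_recl /= expr0 derivZ -polyC1 derivC scaler0 add0r.
  apply: eq_bigr => k _; rewrite /bump /= add1n derivZ derivXn /= -scaler_nat.
  rewrite scalerA divfK ?natf0_neq0 // [RHS]exprNn !exprS !mulN1r opprK.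
  by rewrite -!(signr_odd _ k) scaler_sign mulr_sign.
by rewrite -[RHS]opprB subrX1 -mulNr opprB opprK.
Qed.

(* q = exp (log (1 + X)) - (1 + X) satisfies (1 + X) q' = q and q(0) = 0 modulo X^n. *)
Lemma texp_tlogX n :
  exists q, texp n (tlog n 'X) = 1 + 'X + q * 'X^n :> {poly K}.
Proof.
case: n => [|n].
  by exists (- (1 + 'X)); rewrite /texp big_ord0 expr0 mulr1 subrr.
set y := texp _ _; set l := tlog _ _ in y *; pose q := y - (1 + 'X).
have coef_small r k : (k < n)%N -> ('X^n * r)`_k = 0 :> K.
  by move=> kn; rewrite coefXnM kn.
have [m lm] : exists m, l = 'X * m.
  exists (\sum_(k < n) ((-1) ^+ k.+2 / k.+1%:R : K) *: 'X^k).
  rewrite /l /tlog big_ord_recl invr0 mulr0 scale0r add0r mulr_sumr.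
  by apply: eq_bigr => k _; rewrite -scalerAr -exprS.
(* Both truncation errors, l^n / n! and (-X)^n, are multiples of X^n because l = X m. *)
have ode k : (k < n)%N -> ((1 + 'X) * q^`())`_k = q`_k.
  move=> kn.
  pose M := (n`!%:R^-1 : K) *: m ^+ n.
  have -> : (1 + 'X) * q^`() = q + 'X^n * (- M - (-1) ^+ n * (y - 'X^n * M)).
    have d1 : (1 : {poly K})^`() = 0 by rewrite -polyC1 derivC.
    rewrite /q derivB derivD derivX d1 add0r mulrBr mulr1 deriv_texp -/l -/y.
    rewrite mulrA deriv_tlogX [(- 'X) ^+ n]exprNn {1}lm exprMn scalerAr -/M.
    ring.
  by rewrite coefD coef_small // addr0.
(* The equation reads (k+1) q_{k+1} + k q_k = q_k, so in characteristic zero the vanishing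
   propagates from q_0 = 0. *)
have q0 k : (k < n.+1)%N -> q`_k = 0.
  elim: k => [_|k IH kn].
    rewrite /q coefB coefD coef1 coefX /= addr0 -horner_coef0.
    rewrite /y /texp horner_sum big_ord_recl big1 ?addr0.
      by rewrite /= expr0 invr1 scale1r hornerC subrr.
    move=> j _; rewrite hornerZ horner_exp lm hornerM hornerX mul0r.
    by rewrite exprS mul0r mulr0.
  have := ode k kn; rewrite mulrDl mul1r coefD coefXM coef_deriv IH 1?ltnW //.
  rewrite coef_deriv; case: k {ode} IH kn => [|k] IH kn /=.
    by rewrite addr0 mulr1n.
  rewrite IH 1?ltnW // mul0rn addr0 -mulr_natr => /eqP.
  by rewrite mulf_eq0 (negPf (natf0_neq0 _)) // orbF => /eqP.
exists (drop_poly n.+1 q).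
have := poly_take_drop n.+1 q.
have -> : take_poly n.+1 q = 0.
  by apply/polyP => k; rewrite coef_take_poly coef0; case: ltnP => // /q0.
by rewrite add0r => ->; rewrite addrC subrK.
Qed.

(** The polynomial identity is evaluated at X = v; only powers of v occur, so [B] may be
    noncommutative. *)
Lemma texp_tlog (B : algType K) n (v : B) :
  exists c, texp n (tlog n v) = 1 + v + c * v ^+ n.
Proof.
have [q eq_q] := texp_tlogX n.
exists (horner_alg v q).
have := congr1 (horner_alg v) eq_q.
rewrite !rmorphD rmorph1 rmorphM rmorphXn /= horner_algX => <-.
rewrite linear_sum; apply: eq_bigr => k _; rewrite linearZ /= rmorphXn mulr_algl.
congr (_ *: _).
congr (_ ^+ _); rewrite [RHS]linear_sum; apply: eq_bigr => j _.
by rewrite linearZ /= rmorphXn /= horner_algX mulr_algl.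
Qed.

Definition dpow (B : algType K) (f : B) k := (k`!%:R^-1 : K) *: f ^+ k.

Lemma invfact_bin m k : (m <= k)%N ->
  (k`!%:R^-1 : K) * 'C(k, m)%:R = m`!%:R^-1 * (k - m)`!%:R^-1.
Proof.
move=> mk.
by rewrite -(bin_fact mk) mulnC natrM invfM divfK ?natf0_neq0 ?bin_gt0 // natrM invfM.
Qed.

Lemma dpow_mul (B : algType K) (f y : B) k :
  dpow f k * y = \sum_(m < k.+1) (m`!%:R^-1 : K) *: iter m (ad f) y * dpow f (k - m).
Proof.
rewrite -scalerAl expr_mul_ad scaler_sumr; apply: eq_bigr => m _.
rewrite -scaler_nat scalerA invfact_bin -1?ltnS //.
by rewrite -scalerAl -scalerAr scalerA.
Qed.

Lemma dpow_exprN (B : algType K) (f : B) k :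
  \sum_(m < k.+1) dpow f m * dpow (- f) (k - m) = (k == 0%N)%:R.
Proof.
have -> : (k == 0%N)%:R = (k`!%:R^-1 : K) *: (- f + f) ^+ k.
  by rewrite addNr expr0n; case: k => [|k]; rewrite ?scaler0 // invr1 scale1r.
rewrite exprDn_comm ?scaler_sumr; last exact/commr_sym/commrN.
apply: eq_bigr => m _; have mk : (m <= k)%N by rewrite -ltnS.
rewrite -scaler_nat scalerA invfact_bin // -scalerAl -scalerAr scalerA.
by rewrite (commrX _ (commr_sym (commrX _ (commrN (commr_refl f))))).
Qed.

(** * Exponential, logarithm and linear differential equations for power series *)

Variable A : algType K.
Implicit Types f g y : pseries A.

Lemma ord_geZ k (a : K) f : ord_ge k f -> ord_ge k (a *: f).
Proof. by move=> fk j jk; rewrite psZ fk ?scaler0. Qed.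

Definition psexp f := psum (dpow f).
(** [ead f] is the operator e^{ad f}, and [dexp f] is (e^{ad f} - 1) / ad f. *)
Definition ead f y := psum (fun m => (m`!%:R^-1 : K) *: iter m (ad f) y).
Definition dexp f y := psum (fun m => (m.+1`!%:R^-1 : K) *: iter m (ad f) y).

Lemma summable_dpow f : ord_ge 1 f -> summable (dpow f).
Proof. by move=> f1 k; apply/ord_geZ/ord_geX. Qed.

Lemma summable_ad (c : nat -> K) f y :
  ord_ge 1 f -> summable (fun m => c m *: iter m (ad f) y).
Proof.
by move=> f1 k; apply: ord_geZ; rewrite -[X in ord_ge X]addn0; apply: ord_ge_iter_ad.
Qed.

Lemma psexp_mul f y : ord_ge 1 f -> psexp f * y = ead f y * psexp f.
Proof.
move=> f1; have sd := summable_dpow f1.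
have sa := summable_ad (fun m => m`!%:R^-1) y f1.
by rewrite (psumMr _ sd) (psumM sa sd); apply: eq_psum => k; rewrite dpow_mul.
Qed.

Lemma psexpN f : ord_ge 1 f -> psexp f * psexp (- f) = 1.
Proof.
move=> f1; rewrite psumM; [|exact: summable_dpow|apply: summable_dpow]; last first.
  by move=> j /f1 fj; rewrite psN fj oppr0.
apply/pseriesP => n /=; under eq_bigr => k _ do rewrite dpow_exprN.
rewrite big_ord_recl big1 ?addr0 // => k _; exact: ps0.
Qed.

Lemma ps_derivZ (a : K) f : ps_deriv (a *: f) = a *: ps_deriv f.
Proof. by apply/pseriesP => n /=; rewrite scalerMnr. Qed.

(** Duhamel's formula for the derivative of an exponential, obtained termwise from
    [ps_deriv_expr]. *)
Lemma deriv_psexp f : ord_ge 1 f ->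
  ps_deriv (psexp f) = dexp f (ps_deriv f) * psexp f.
Proof.
move=> f1; rewrite ps_deriv_psum; last first.
- by rewrite /dpow invr1 scale1r.
- exact: summable_dpow.
rewrite psumM; [|exact: summable_ad|exact: summable_dpow].
apply: eq_psum => k; rewrite /dpow ps_derivZ ps_deriv_expr scaler_sumr.
apply: eq_bigr => m _; have mk : (m <= k)%N by rewrite -ltnS.
by rewrite -scaler_nat scalerA invfact_bin // subSS -scalerAl -scalerAr scalerA.
Qed.

(** Coefficient n of the equation gives (n+1) f_{n+1} in terms of f_0, ..., f_n. *)
Lemma ode_unique a f g : ps_deriv f = a * f -> ps_deriv g = a * g ->
  f 0%N = g 0%N -> f = g.
Proof.
move=> fa ga fg0; apply/pseriesP => n.
elim/ltn_ind: n => -[//|n] IH.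
have : ps_deriv f n = ps_deriv g n.
  by rewrite fa ga; apply: ps_mul_local => // k kn; apply: IH.
rewrite /= -!scaler_nat => /(scalerI (natf0_neq0 (ltn0Sn n))); exact.
Qed.

Definition pslog g := psum (fun k => ((-1) ^+ k.+1 / k%:R : K) *: (g - 1) ^+ k).

Lemma summable_pslog g : g 0%N = 1 ->
  summable (fun k => ((-1) ^+ k.+1 / k%:R : K) *: (g - 1) ^+ k).
Proof.
move=> g0 k; apply/ord_geZ/ord_geX => -[|//] _.
by rewrite psB g0 ps1 subrr.
Qed.

Lemma pslog0 g : g 0%N = 1 -> ord_ge 1 (pslog g).
Proof.
by move=> g0 [|//] _ /=; rewrite big_ord1 invr0 mulr0 scale0r.
Qed.

(** In coefficient n both series may be truncated, and the error c (g - 1)^(n+1) of [texp_tlog] has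
    order greater than n. *)
Lemma psexp_pslog g : g 0%N = 1 -> psexp (pslog g) = g.
Proof.
move=> g0; have l1 := pslog0 g0; have sl := summable_pslog g0.
have g1 : ord_ge 1 (g - 1) by move=> -[|//] _; rewrite psB g0 ps1 subrr.
apply/pseriesP => n; rewrite (psumE (summable_dpow l1) (ltnSn n)).
have [c] := texp_tlog n.+1 (g - 1).
move=> /(congr1 (fun f : pseries A => f n)).
rewrite [1 + _]addrC subrK psD (_ : (c * _) n = 0) ?addr0 => [<-|]; last first.
  have := ord_geM (k := 0) (f := c) _ (ord_geX (k := n.+1) g1); apply=> //; exact: ltnSn.
rewrite !ps_sum; apply: eq_bigr => k _; rewrite !psZ; congr (_ *: _).
have expr_local j : (forall m, (m <= n)%N ->
    (pslog g ^+ j) m = (tlog n.+1 (g - 1) ^+ j) m).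
  elim: j => [//|j IH] m mn; rewrite !exprS.
  apply: ps_mul_local => l lm; last exact: IH (leq_trans lm mn).
  by apply: (psumE sl); rewrite ltnS (leq_trans lm mn).
exact: expr_local.
Qed.

End ExpLog.

(** * The filtration of the enveloping algebra *)

Section Filtration.
Variables (K : fieldType) (V : lmodType K) (br : V -> V -> V) (F : nat -> V -> Prop).
Hypothesis filtF : is_lie_filtration br F.
Variables (A : algType K) (i : {linear V -> A}).
Hypothesis ibr : forall x y, i (br x y) = i x * i y - i y * i x.
Hypothesis A_ind : forall P : A -> Prop, P 1 ->
  (forall a x y, P x -> P y -> P (a *: x + y)) ->
  (forall x y, P x -> P y -> P (x * y)) ->
  (forall x, P (i x)) -> forall u, P u.
Variables (R : V -> V) (cR : {linear A -> A}).
Hypothesis RF : forall n x, (1 <= n)%N -> F n x -> F n (R x).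
Hypotheses (cR1 : cR 1 = 1) (cRi : forall x, cR (i x) = i (R x)).
Hypothesis cRM : forall x h, cR (i x * h) = i (R x) * cR h - cR (i (R x) * h - h * i (R x)).

Let F0 n : (1 <= n)%N -> F n 0. Proof. by case: filtF => H _ _ _ _; apply: H. Qed.
Let FL n a x y : (1 <= n)%N -> F n x -> F n y -> F n (a *: x + y).
Proof. by case: filtF => _ H _ _ _; apply: H. Qed.
Let F1 x : F 1 x. Proof. by case: filtF => _ _ H _ _; apply: H. Qed.
Let Fbr n m x y : (1 <= n)%N -> (1 <= m)%N -> F n x -> F m y -> F (n + m) (br x y).
Proof. by case: filtF => _ _ _ _ H; apply: H. Qed.

(** A list of pairs (n_j, x_j) is a product of Lie elements with chosen filtration degrees, as in
    [FU]; the weight reads these labels, not the value of the product. *)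
Definition weight (p : seq (nat * V)) := (\sum_(q <- p) q.1)%N.
Definition monomial (p : seq (nat * V)) := \prod_(q <- p) i q.2.
Definition admissible (p : seq (nat * V)) := forall q, q \in p -> (1 <= q.1)%N /\ F q.1 q.2.

Lemma admissible_cons q p :
  admissible (q :: p) <-> ((1 <= q.1)%N /\ F q.1 q.2) /\ admissible p.
Proof.
split=> [ok|[okq okp] r]; last by rewrite inE => /predU1P[->|/okp].
by split=> [|r rp]; apply: ok; rewrite inE ?eqxx ?rp ?orbT.
Qed.

Lemma admissible_cat p q : admissible p -> admissible q -> admissible (p ++ q).
Proof. by move=> okp okq r; rewrite mem_cat => /orP[/okp|/okq]. Qed.

Lemma monomial1 n x : monomial [:: (n, x)] = i x.
Proof. exact: big_seq1. Qed.
Lemma monomial_cat p q : monomial (p ++ q) = monomial p * monomial q.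
Proof. exact: big_cat. Qed.
Lemma weight1 n x : weight [:: (n, x)] = n.
Proof. exact: big_seq1. Qed.
Lemma weight_cat p q : weight (p ++ q) = (weight p + weight q)%N.
Proof. exact: big_cat. Qed.

Lemma FU_monomial n p : admissible p -> (n <= weight p)%N -> FU F i n (monomial p).
Proof.
case: n => [//|n] okp np; exists [:: (1, p)]; split.
- by rewrite big_seq1 scale1r.
- move=> w; rewrite inE => /eqP -> /=; split=> //.
  by apply/eqP => p0; move: np; rewrite p0 /weight big_nil.
- by move=> w q; rewrite inE => /eqP -> /=; apply: okp.
Qed.

Lemma FU0 n : FU F i n 0.
Proof. by case: n => [//|n]; exists [::]; split=> //; rewrite big_nil. Qed.

Lemma FUL n a x y : FU F i n x -> FU F i n y -> FU F i n (a *: x + y).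
Proof.
case: n => [//|n] [ws [-> wsn wsF]] [vs [-> vsn vsF]].
exists ([seq (a * w.1, w.2) | w <- ws] ++ vs); split.
- rewrite big_cat big_map /= scaler_sumr; congr (_ + _).
  by apply: eq_bigr => w _; rewrite scalerA.
- by move=> w; rewrite mem_cat => /orP[/mapP[w' /wsn ? ->] //|/vsn].
- by move=> w p; rewrite mem_cat => /orP[/mapP[w' ww ->]|]; [apply: wsF ww|apply: vsF].
Qed.

Lemma FUD n x y : FU F i n x -> FU F i n y -> FU F i n (x + y).
Proof. by move=> xn yn; rewrite -[x]scale1r; apply: FUL. Qed.

Lemma FUZ n a x : FU F i n x -> FU F i n (a *: x).
Proof. by move=> xn; rewrite -[_ *: _]addr0; apply/FUL/FU0. Qed.

Lemma FUN n x : FU F i n x -> FU F i n (- x).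
Proof. by move=> xn; rewrite -scaleN1r; apply: FUZ. Qed.

Lemma FUB n x y : FU F i n x -> FU F i n y -> FU F i n (x - y).
Proof. by move=> xn yn; apply/FUD/FUN. Qed.

Lemma FU_sum n (I : Type) (r : seq I) (P : pred I) (u : I -> A) :
  (forall k, P k -> FU F i n (u k)) -> FU F i n (\sum_(k <- r | P k) u k).
Proof. by move=> un; elim/big_ind: _ => //; [apply: FU0 | apply: FUD]. Qed.

Lemma FU_ind n (P : A -> Prop) : (1 <= n)%N -> P 0 ->
  (forall a x y, P x -> P y -> P (a *: x + y)) ->
  (forall p, admissible p -> (n <= weight p)%N -> P (monomial p)) ->
  forall u, FU F i n u -> P u.
Proof.
case: n => [//|n] _ P0 PL Pmon u [ws [-> wsn wsF]].
rewrite big_seq; elim/big_rec: _ => // w x ww Px; apply: PL => //.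
by apply: Pmon => [q /(wsF w _ ww)//|]; have [] := wsn w ww.
Qed.

Lemma FUW n m u : (m <= n)%N -> FU F i n u -> FU F i m u.
Proof.
case: m n => [//|m] [//|n] mn; apply: FU_ind => //; first exact: FU0.
  by move=> *; apply: FUL.
by move=> p okp np; apply: FU_monomial => //; apply: leq_trans np.
Qed.

Lemma FUi n x : (1 <= n)%N -> F n x -> FU F i n (i x).
Proof.
move=> n1 xn; rewrite -(monomial1 n x); apply: FU_monomial; last by rewrite weight1.
by move=> q; rewrite inE => /eqP ->.
Qed.

(** Induction on the multiplier reduces to a = i x. Since F_1 is the whole Lie algebra, x may be
    attached to a monomial with label 1. *)
Lemma FU_ideal n u : FU F i n u -> forall a, FU F i n (a * u) /\ FU F i n (u * a).
Proof.
case: n => [//|n] un a; elim/A_ind: a u un => [u||a b IHa IHb u un|x].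
- by rewrite mul1r mulr1.
- move=> c a b IHa IHb u un; have [au ua] := IHa u un; have [bu ub] := IHb u un.
  by rewrite mulrDl mulrDr -scalerAl -scalerAr; split; apply: FUL.
- split; [rewrite -mulrA | rewrite mulrA].
    exact: (IHa _ (IHb _ un).1).1.
  exact: (IHb _ (IHa _ un).2).2.
apply: FU_ind => //; first by rewrite mulr0 mul0r; split; apply: FU0.
  move=> c u' v [xu ux] [xv vx].
  by rewrite mulrDl mulrDr -scalerAl -scalerAr; split; apply: FUL.
move=> p okp np; have ok1 : admissible [:: (1%N, x)].
  by move=> q; rewrite inE => /eqP -> /=.
split.
  rewrite -(monomial1 1 x) -monomial_cat.
  apply: FU_monomial; first exact: admissible_cat.
  by rewrite weight_cat weight1 (leq_trans np) ?leq_addl.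
rewrite -(monomial1 1 x) -monomial_cat.
apply: FU_monomial; first exact: admissible_cat.
by rewrite weight_cat weight1 (leq_trans np) ?leq_addr.
Qed.

Lemma FUM n m u v : FU F i n u -> FU F i m v -> FU F i (n + m) (u * v).
Proof.
case: n => [|n] un vm; first by have [] := FU_ideal vm u.
case: m vm => [|m] vm; first by rewrite addn0; have [] := FU_ideal un v.
move: u un; apply: FU_ind => //; first by rewrite mul0r; apply: FU0.
  by move=> a x y xv yv; rewrite mulrDl -scalerAl; apply: FUL.
move=> p okp np; move: v vm; apply: FU_ind => //; first by rewrite mulr0; apply: FU0.
  by move=> a x y xv yv; rewrite mulrDr -scalerAr; apply: FUL.
move=> q okq mq; rewrite -monomial_cat; apply: FU_monomial; first exact: admissible_cat.
by rewrite weight_cat leq_add.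
Qed.

(** The derivation [ad (i x)] replaces one factor x_j at a time by [x, x_j]: the length is kept and
    the weight grows by n. *)
Lemma ad_monomial (P : A -> Prop) n x p : (1 <= n)%N -> F n x -> admissible p ->
  P 0 -> (forall u v, P u -> P v -> P (u + v)) ->
  (forall q, size q = size p -> weight q = (n + weight p)%N -> admissible q ->
     P (monomial q)) ->
  P (ad (i x) (monomial p)).
Proof.
move=> n1 xn; elim: p P => [|q p IH] P okp P0 PD Pmon.
  by rewrite /ad /monomial big_nil mulr1 mul1r subrr.
have [[q1 qF] okp'] := (admissible_cons _ _).1 okp.
have -> : ad (i x) (monomial (q :: p)) =
    monomial ((n + q.1, br x q.2)%N :: p) + i q.2 * ad (i x) (monomial p).
  rewrite /ad /monomial !big_cons /= ibr mulrBl mulrBr -!mulrA.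
  by rewrite addrA subrK.
apply: (PD).
  apply: Pmon => //; first by rewrite /weight !big_cons /= addnA.
  by apply/admissible_cons; split=> //=; split; [rewrite addn_gt0 n1 | apply: Fbr].
(* The first factor is absorbed into the predicate. *)
apply: (IH (fun u => P (i q.2 * u))) => //.
- by rewrite mulr0.
- by move=> u v Pu Pv; rewrite mulrDr; apply: PD.
move=> r sr wr okr; have -> : i q.2 * monomial r = monomial (q :: r) by rewrite /monomial big_cons.
apply: Pmon; first by rewrite /= sr.
  by rewrite /weight !big_cons -/(weight _) wr addnCA.
exact/admissible_cons.
Qed.

(** Induction on the length, because the recursion for [cR] (x h) calls [cR] on h and on the
    monomials of [R x, h]. The latter are not sublists, but they are as long as h and carry the full
    weight. *)
Lemma cR_monomial k p : size p = k -> admissible p -> FU F i (weight p) (cR (monomial p)).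
Proof.
elim: k p => [|k IH] [|q p] //= szp okp; first by rewrite /weight big_nil.
have [[q1 qF] okp'] := (admissible_cons _ _).1 okp.
have wE : weight (q :: p) = (q.1 + weight p)%N by rewrite /weight big_cons.
rewrite wE [monomial _]big_cons cRM.
apply: FUB; first by apply: FUM; [exact/FUi/RF | apply: IH => //; case: szp].
apply: (ad_monomial (n := q.1) (P := fun u => FU F i _ (cR u))) => //.
- exact: RF.
- by rewrite raddf0; apply: FU0.
- by move=> u v un vn; rewrite raddfD; apply: FUD.
move=> r sr wr okr; rewrite -wr; apply: IH => //.
by rewrite sr; case: szp.
Qed.

Lemma cR_FU n u : FU F i n u -> FU F i n (cR u).
Proof.
case: n => [//|n]; move: u; apply: FU_ind => //; first by rewrite raddf0; apply: FU0.
  by move=> a x y xn yn; rewrite linearP; apply: FUL.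
by move=> p okp np; apply: FUW np _; apply: (cR_monomial (erefl _) okp).
Qed.

(** * Lie series and the operator cR *)

(* F 0 is unspecified; index 0 is made to stand for the zero subspace. *)
Definition lie_part n (a : A) := exists2 v, (if n is 0 then v = 0 else F n v) & a = i v.

Lemma lie_part0 n : lie_part n 0.
Proof. by exists 0; rewrite ?raddf0 //; case: n => // n; apply: F0. Qed.

Lemma lie_partL n c a b : lie_part n a -> lie_part n b -> lie_part n (c *: a + b).
Proof.
move=> [v vn ->] [w wn ->]; exists (c *: v + w); last by rewrite linearP.
by case: n vn wn => [-> ->|n vn wn]; rewrite ?scaler0 ?addr0 //; apply: FL.
Qed.

Lemma lie_partD n a b : lie_part n a -> lie_part n b -> lie_part n (a + b).
Proof. by move=> an bn; rewrite -[a]scale1r; apply: lie_partL. Qed.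

Lemma lie_partZ n c a : lie_part n a -> lie_part n (c *: a).
Proof. by move=> an; rewrite -[_ *: _]addr0; apply/lie_partL/lie_part0. Qed.

Lemma lie_partB n a b : lie_part n a -> lie_part n b -> lie_part n (a - b).
Proof. by move=> an bn; rewrite addrC -scaleN1r; apply: lie_partL. Qed.

Lemma lie_part_sum n (I : Type) (r : seq I) (P : pred I) (u : I -> A) :
  (forall k, P k -> lie_part n (u k)) -> lie_part n (\sum_(k <- r | P k) u k).
Proof. by move=> un; elim/big_ind: _ => //; [apply: lie_part0 | apply: lie_partD]. Qed.

Lemma lie_part_ad n m a b : lie_part n a -> lie_part m b -> lie_part (n + m) (ad a b).
Proof.
move=> [v vn ->] [w wm ->]; case: n vn => [->|n vn].
  by rewrite raddf0 /ad mul0r mulr0 subrr; apply: lie_part0.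
case: m wm => [->|m wm].
  by rewrite raddf0 /ad mul0r mulr0 subrr; apply: lie_part0.
by exists (br v w); [apply: (@Fbr n.+1 m.+1) | rewrite ibr].
Qed.

Lemma lie_part_cR n a : lie_part n.+1 a -> lie_part n.+1 (cR a).
Proof. by move=> [v vn ->]; exists (R v); [apply: RF | rewrite cRi]. Qed.

Lemma lie_part_FU n a : lie_part n a -> FU F i n a.
Proof. by case: n => [//|n] [v vn ->]; apply: FUi. Qed.

Lemma cRM_lie n a u : lie_part n a -> cR (a * u) = cR a * cR u - cR (ad (cR a) u).
Proof. by move=> [v _ ->]; rewrite cRM -cRi. Qed.

Section Series.
Hypothesis charK0 : [pchar K] =i pred0.
Implicit Types f g y w : pseries A.

Lemma ps_mul_rev f g n : (f * g) n = \sum_(j < n.+1) f (n - j)%N * g j.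
Proof.
rewrite psM (reindex_inj rev_ord_inj) /=; apply: eq_bigr => j _.
by rewrite subSS subKn // -ltnS.
Qed.

Lemma ad_coef f y n : (ad f y) n = \sum_(j < n.+1) ad (f j) (y (n - j)%N).
Proof. by rewrite psB psM ps_mul_rev -sumrB. Qed.

(** As f_0 = 0, coefficient n of [f, y] involves y_k only for k < n. This strictness drives the
    induction on the coefficients of the logarithm. *)
Lemma lie_part_ad_coef f y s n : f 0%N = 0 ->
  (forall k, (k <= n)%N -> lie_part k (f k)) ->
  (forall k, (k < n)%N -> lie_part (k + s) (y k)) ->
  lie_part (n + s) ((ad f y) n).
Proof.
move=> f0 fG yG; rewrite ad_coef; apply: lie_part_sum => -[[|j] jn] _ /=.
  by rewrite f0 /ad mul0r mulr0 subrr; apply: lie_part0.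
rewrite ltnS in jn; rewrite -{1}(subnKC jn) -addnA.
by apply: lie_part_ad; [apply: fG | apply: yG; rewrite ltn_subrL (leq_trans _ jn)].
Qed.

Lemma lie_part_iter_ad f y s n m : f 0%N = 0 ->
  (forall k, (k <= n)%N -> lie_part k (f k)) ->
  (forall k, (k < n)%N -> lie_part (k + s) (y k)) ->
  lie_part (n + s) ((iter m.+1 (ad f) y) n).
Proof.
move=> f0 fG yG; have sub k : (k < n)%N -> lie_part (k + s) ((iter m (ad f) y) k).
  elim: m k => [//|m IH] k kn; apply: lie_part_ad_coef => // j jk.
    by apply: fG; apply: leq_trans jk (ltnW kn).
  exact: IH (ltn_trans jk kn).
exact: lie_part_ad_coef.
Qed.

(** The shift s = 1 accommodates derivatives, whose coefficient k comes from coefficient k + 1. *)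
Definition lie_series s f := forall k, lie_part (k + s) (f k).

(** The free coefficients c cover [ead] and [dexp] together. *)
Lemma lie_series_ad_sum (c : nat -> K) f y s : f 0%N = 0 -> lie_series 0 f ->
  lie_series s y -> lie_series s (psum (fun m => c m *: iter m (ad f) y)).
Proof.
move=> f0 fG yG n; apply: lie_part_sum => m _; apply: lie_partZ.
case: (m : nat) => [|k]; first exact: yG.
by apply: lie_part_iter_ad => // j _; have := fG j; rewrite addn0.
Qed.

Definition cRs f : pseries A := Pseries (fun n => cR (f n)).

Lemma cRs_coef f n : cRs f n = cR (f n). Proof. by []. Qed.
Lemma cRsD f g : cRs (f + g) = cRs f + cRs g.
Proof. by apply/pseriesP => n; rewrite /= raddfD. Qed.
Lemma deriv_cRs f : ps_deriv (cRs f) = cRs (ps_deriv f).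
Proof. by apply/pseriesP => n; rewrite /= raddfMn. Qed.

(** The recursion for [cR] is bilinear, so it passes to series whose left factor has Lie
    coefficients. *)
Lemma cRsM s y u : lie_series s y -> cRs (y * u) = cRs y * cRs u - cRs (ad (cRs y) u).
Proof.
move=> yG; apply/pseriesP => n; rewrite psB [LHS]/= psM raddf_sum /=.
rewrite -/(ad (cRs y) u) -[cR (_ - _)]/(cR ((ad (cRs y) u) n)) ad_coef raddf_sum -sumrB.
by apply: eq_bigr => j _; apply: cRM_lie (yG _).
Qed.

Lemma lie_series_cRs s y : lie_series s.+1 y -> lie_series s.+1 (cRs y).
Proof. by move=> yG n; rewrite addnS; apply: lie_part_cR; rewrite -addnS. Qed.

(** Neumann series: [T] raises the t-order, so the sum of the T^k xi exists and solves b = xi + T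
    b. *)
Lemma psum_fixpoint (T : pseries A -> pseries A) (xi : pseries A) :
  {morph T : x y / x + y} ->
  (forall z n, ord_ge n z -> ord_ge n.+1 (T z)) ->
  psum (fun k => iter k T xi) = xi + T (psum (fun k => iter k T xi)).
Proof.
move=> TD Tord; set b := psum _.
have T0 : T 0 = 0 by apply: (addIr (T 0)); rewrite -TD !add0r.
have sT : summable (fun k => iter k T xi) by elim=> [//|k]; apply: Tord.
apply/pseriesP => n; rewrite psD.
(* Coefficient n of T b depends only on b modulo t^n, so b may be replaced by a partial sum. *)
have -> : T b n = (T (\sum_(k < n) iter k T xi)) n.
  rewrite -[b in LHS](subrK (\sum_(k < n) iter k T xi)) TD psD (Tord _ n) ?add0r //.
  by move=> j jn; rewrite psB (psumE sT jn) subrr.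
by rewrite (big_morph T TD T0) ps_sum [LHS]/= big_ord_recl.
Qed.

Lemma psum_recl (u : nat -> pseries A) n :
  psum u n = u 0%N n + \sum_(m < n) u m.+1 n.
Proof. by rewrite [LHS]/= big_ord_recl. Qed.

Lemma eadD f : {morph ead f : x y / x + y}.
Proof.
move=> x y; apply/pseriesP => n; rewrite psD /= -big_split; apply: eq_bigr => m _ /=.
rewrite -scalerDr -psD; congr (_ *: pcoef _ _).
elim: (m : nat) => [//|k /= ->]; rewrite /ad mulrDr mulrDl opprD.
by rewrite addrACA.
Qed.

(** With xi = b - (e^{ad f} a - a) and E a = (e^{ad f} a) E, the derivative of E w is b E w +
    [a, E w]. By [cRsM], applying [cRs] to b E w gives a [cRs] (E w) minus the image of [a, E w],
    and the commutators cancel. *)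
Lemma ode_cRs f : f 0%N = 0 -> lie_series 0 f ->
  exists2 a, lie_series 1 a & forall w, ps_deriv w = ad a w ->
    ps_deriv (cRs (psexp f * w)) = a * cRs (psexp f * w).
Proof.
move=> f0 fG; have f1 : ord_ge 1 f by case.
pose xi := dexp f (ps_deriv f).
have xiG : lie_series 1 xi.
  apply: lie_series_ad_sum => // n; rewrite addn1 /= -scaler_nat.
  by apply: lie_partZ; have := fG n.+1; rewrite addn0.
pose T z := ead f (cRs z) - cRs z.
pose b := psum (fun k => iter k T xi).
have bE : b = xi + T b.
  apply: psum_fixpoint => [x y|z n zn].
    by rewrite /T cRsD eadD opprD addrACA.
  have zn' : ord_ge n (cRs z) by move=> j jn /=; rewrite zn ?raddf0.
  (* The term m = 0 of [ead] cancels; every other term contains a factor [ad f], which raises the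
     order. *)
  move=> j jn; rewrite psB [X in X - _]psum_recl invr1 scale1r addrAC subrr add0r.
  rewrite big1 // => m _; rewrite psZ (_ : pcoef _ _ = 0) ?scaler0 //.
  apply: (ord_ge_iter_ad (k := m.+1) f1 zn'); apply: leq_trans jn _.
  by rewrite addSn ltnS leq_addl.
have bG : lie_series 1 b.
  move=> n; apply: lie_part_sum => -[k /= _] _; elim: k n => [|k IH] n; first exact: xiG.
  rewrite iterS psB; apply: lie_partB; last exact: lie_series_cRs.
  by apply: lie_series_ad_sum => //; apply: lie_series_cRs.
exists (cRs b) => [|w dw]; first exact: lie_series_cRs.
 set a := cRs b in dw *; set E := psexp f.
rewrite deriv_cRs.
have -> : ps_deriv (E * w) = b * (E * w) + ad a (E * w).
  rewrite ps_derivM deriv_psexp // -/E -/xi dw.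
  have -> : xi = b - (ead f a - a) by rewrite {1}bE addrK.
  have Ea : E * a = ead f a * E by apply: psexp_mul.
  by rewrite /ad mulrBr !mulrBl !mulrA Ea opprB -addrA subrKA.
by rewrite cRsD (cRsM _ bG) subrK.
Qed.

(** [cR] thus preserves exponentials of Lie series. The last clause becomes the Rota-Baxter identity
    at t = 1 when h is the exponential of the second argument. *)
Lemma grouplike_series f : f 0%N = 0 -> lie_series 0 f ->
  exists Om : pseries A, [/\ Om 0%N = 0, lie_series 0 Om, psexp Om = cRs (psexp f), Om = pslog (cRs (psexp f)) &
    forall h, cRs (psexp f * (psexp Om * ps_const h * psexp (- Om)))
              = psexp Om * ps_const (cR h)].
Proof.
move=> f0 fG; have [a aG ode] := ode_cRs f0 fG.
have psexp0 y : psexp y 0%N = 1 by rewrite /= big_ord1 /= invr1 scale1r.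
have E0 := psexp0 f.
set E := psexp f in ode E0 *; pose g := cRs E.
have g0 : g 0%N = 1 by rewrite -[LHS]/(cR (E 0%N)) E0.
pose Om := pslog g; have Om1 : ord_ge 1 Om by apply: pslog0.
have gE : psexp Om = g by apply: psexp_pslog.
have dg : ps_deriv g = a * g.
  have d1 : ps_deriv (1 : pseries A) = ad a 1.
    by rewrite /ad mulr1 mul1r subrr; apply/pseriesP => n; rewrite ps0 /= mul0rn.
  by have := ode _ d1; rewrite mulr1.
have ggi : g * psexp (- Om) = 1 by rewrite -gE psexpN.
have gig : psexp (- Om) * g = 1.
  rewrite -gE -{2}[Om]opprK psexpN // => j /Om1 Omj.
  by rewrite psN Omj oppr0.
exists Om; split=> // [|n|h]; first exact: Om1.
- rewrite addn0; elim/ltn_ind: n => -[_|n IH].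
    by rewrite Om1 //; apply: lie_part0.
  have aE : a = dexp Om (ps_deriv Om).
    have /(congr1 ( *%R^~ (psexp (- Om)))) : a * g = dexp Om (ps_deriv Om) * g.
      by have := deriv_psexp charK0 Om1; rewrite gE dg.
    by rewrite -!mulrA ggi !mulr1.
  (* At t^n the term m = 0 of [dexp] is (n+1) Om_{n+1}; the others involve Om_k with k <= n, which
     are Lie by induction. *)
  have := congr1 (fun z : pseries A => z n) aE; rewrite psum_recl invr1 scale1r.
  move=> /esym/eqP; rewrite eq_sym -subr_eq => /eqP dOm.
  have -> : Om n.+1 = (n.+1%:R^-1 : K) *: ps_deriv Om n.
    by rewrite /= -scaler_nat scalerA mulVf ?scale1r ?natf0_neq0.
  apply: lie_partZ; rewrite -dOm -[n.+1]addn1; apply: lie_partB; first exact: aG.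
  apply: lie_part_sum => m _; apply: lie_partZ.
  apply: lie_part_iter_ad => [|k kn|k kn]; [exact: Om1 | exact: IH |].
  by rewrite addn1 /= -scaler_nat; apply/lie_partZ/IH.
- have gi0 := psexp0 (- Om); rewrite gE; set gi := psexp (- Om) in ggi gig gi0 *.
  have dgi : ps_deriv gi = - (gi * a).
    have : ps_deriv (g * gi) = 0.
      by rewrite ggi; apply/pseriesP => n; rewrite ps0 /= mul0rn.
    rewrite ps_derivM dg -mulrA ggi mulr1 => /(congr1 ( *%R gi)).
    by rewrite mulr0 mulrDr mulrA gig mul1r => /eqP; rewrite addrC addr_eq0 => /eqP.
  have dconst c : ps_deriv (ps_const c) = 0 :> pseries A.
    by apply/pseriesP => n; rewrite ps0 /= mul0rn.
  (* Both sides solve z' = a z: the left one by [ode], because w = g h gi satisfies w' = [a, w]. At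
     t = 0 both equal [cR h]. *)
  apply: (@ode_unique _ charK0 _ a).
  + apply: ode; rewrite !ps_derivM dg dgi dconst mulr0 addr0.
    by rewrite /ad mulrN !mulrA.
  + by rewrite ps_derivM dg dconst mulr0 addr0 mulrA.
  + have mul0 (p q : pseries A) : (p * q) 0%N = p 0%N * q 0%N by rewrite psM big_ord1.
    by rewrite cRs_coef !mul0 g0 E0 gi0 !mul1r !mulr1.
Qed.

(** * Specialization at t = 1 modulo the filtration *)

Definition eqU n (u v : A) := FU F i n (u - v).

Lemma eqU_refl n u : eqU n u u. Proof. by rewrite /eqU subrr; apply: FU0. Qed.
Lemma eqU_sym n u v : eqU n u v -> eqU n v u.
Proof. by move=> uv; rewrite /eqU -opprB; apply: FUN. Qed.
Lemma eqU_trans n v u (w : A) : eqU n u v -> eqU n v w -> eqU n u w.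
Proof. by move=> uv vw; rewrite /eqU -(subrKA v); apply: FUD. Qed.
Lemma eqUD n u v u' v' : eqU n u u' -> eqU n v v' -> eqU n (u + v) (u' + v').
Proof. by move=> uu vv; rewrite /eqU opprD addrACA; apply: FUD. Qed.
Lemma eqUN n u v : eqU n u v -> eqU n (- u) (- v).
Proof. by move=> uv; rewrite /eqU -opprD; apply: FUN. Qed.
Lemma eqUZ n c u v : eqU n u v -> eqU n (c *: u) (c *: v).
Proof. by move=> uv; rewrite /eqU -scalerBr; apply: FUZ. Qed.
Lemma eqU_sum n (I : Type) (r : seq I) (P : pred I) (u v : I -> A) :
  (forall k, P k -> eqU n (u k) (v k)) ->
  eqU n (\sum_(k <- r | P k) u k) (\sum_(k <- r | P k) v k).
Proof. by move=> uv; rewrite /eqU -sumrB; apply: FU_sum. Qed.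
Lemma eqUM n u v u' v' : eqU n u u' -> eqU n v v' -> eqU n (u * v) (u' * v').
Proof.
move=> uu vv; apply: (@eqU_trans n (u' * v)).
  by rewrite /eqU -mulrBl; have [] := FU_ideal uu v.
by rewrite /eqU -mulrBr; have [] := FU_ideal vv u'.
Qed.
Lemma eqUX n u v k : eqU n u v -> eqU n (u ^+ k) (v ^+ k).
Proof.
move=> uv; elim: k => [|k IH]; first exact: eqU_refl.
by rewrite !exprS; apply: eqUM.
Qed.
Lemma eqU_cR n u v : eqU n u v -> eqU n (cR u) (cR v).
Proof. by move=> uv; rewrite /eqU -raddfB; apply: cR_FU. Qed.

Definition tsum (c : nat -> K) n (u : A) := \sum_(k < n) c k *: u ^+ k.
Lemma eqU_tsum c n u v : eqU n u v -> eqU n (tsum c n u) (tsum c n v).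
Proof. by move=> uv; apply: eqU_sum => k _; apply/eqUZ/eqUX. Qed.

Definition FU_series f := forall k, FU F i k (f k).
(** The value at t = 1 modulo F_n U: for an [FU_series] the omitted coefficients lie in F_n U. *)
Definition eval n f : A := \sum_(k < n) f k.

Lemma lie_series_FU f : lie_series 0 f -> FU_series f.
Proof. by move=> fG k; apply: lie_part_FU; have := fG k; rewrite addn0. Qed.

Lemma FU_seriesM f g : FU_series f -> FU_series g -> FU_series (f * g).
Proof.
move=> fF gF k; rewrite psM; apply: FU_sum => j _.
have jk : (j <= k)%N by rewrite -ltnS.
by rewrite -[X in FU _ _ X](subnKC jk); apply: FUM.
Qed.

Lemma FU_series1 : FU_series 1.
Proof. by case=> [//|n]; rewrite ps1; apply: FU0. Qed.

Lemma FU_seriesX f k : FU_series f -> FU_series (f ^+ k).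
Proof.
by move=> fF; elim: k => [|k IH]; [apply: FU_series1 | rewrite exprS; apply: FU_seriesM].
Qed.

Lemma FU_series_psum (c : nat -> K) f :
  FU_series f -> FU_series (psum (fun k => c k *: f ^+ k)).
Proof. by move=> fF n; apply: FU_sum => k _; apply/FUZ/FU_seriesX. Qed.

(** The discarded products f_j g_l have j + l >= n and lie in F_n U. *)
Lemma evalM n f g : FU_series f -> FU_series g ->
  eqU n (eval n f * eval n g) (eval n (f * g)).
Proof.
move=> fF gF; apply: (@mul_partial_sums A (FU F i n)); [exact: FU0 | exact: FUD |].
by move=> j l njl; apply: FUW njl _; apply: FUM.
Qed.

Lemma evalB n f g : eval n (f - g) = eval n f - eval n g.
Proof. by rewrite /eval -sumrB. Qed.
Lemma evalN n f : eval n (- f) = - eval n f.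
Proof. by rewrite /eval -sumrN. Qed.
Lemma eval_cRs n f : eval n (cRs f) = cR (eval n f).
Proof. by rewrite raddf_sum. Qed.
(** At level 0 [eval] is an empty sum, hence the levels [n.+1]; level 0 is trivial as F_0 U is all
    of U. *)
Lemma eval_const n a : eval n.+1 (ps_const a) = a.
Proof. by rewrite /eval big_ord_recl big1 /= ?addr0. Qed.

Lemma evalX n f k : FU_series f -> eqU n.+1 (eval n.+1 f ^+ k) (eval n.+1 (f ^+ k)).
Proof.
move=> fF; elim: k => [|k IH]; first by rewrite eval_const; apply: eqU_refl.
rewrite !exprS; apply: eqU_trans (eqUM (eqU_refl _ _) IH) _.
by apply: evalM => //; apply: FU_seriesX.
Qed.

Lemma eval_tsum c n f : ord_ge 1 f -> FU_series f ->
  eqU n.+1 (tsum c n.+1 (eval n.+1 f)) (eval n.+1 (psum (fun k => c k *: f ^+ k))).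
Proof.
move=> f1 fF; have -> : eval n.+1 (psum (fun k => c k *: f ^+ k)) =
    \sum_(k < n.+1) c k *: eval n.+1 (f ^+ k).
  under [RHS]eq_bigr => k _ do rewrite scaler_sumr.
  rewrite exchange_big /=; apply: eq_bigr => -[m mn] _.
  by rewrite (psumE (N := n.+1)) ?ps_sum // => k; apply/ord_geZ/ord_geX.
by apply: eqU_sum => k _; apply/eqUZ/evalX.
Qed.

(** * Truncated exponentials and logarithms modulo the filtration *)

Lemma texpE n u : texp n u = tsum (fun k => k`!%:R^-1) n u. Proof. by []. Qed.
Lemma tlogE n u : tlog n u = tsum (fun k => (-1) ^+ k.+1 / k%:R) n u. Proof. by []. Qed.

Lemma ulogE (u : nat -> A) n : ulog u n = tlog n (u n - 1).
Proof.
rewrite /ulog /tlog; case: n => [|n]; first by rewrite big_geq // big_ord0.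
rewrite big_ord_recl invr0 mulr0 scale0r add0r big_add1 big_mkord.
exact: eq_bigr.
Qed.

Lemma FU1_X n u : FU F i 1 u -> FU F i n (u ^+ n).
Proof. by move=> u1; elim: n => [//|n IH]; rewrite exprS -add1n; apply: FUM. Qed.

(** The error is a multiple of (u - 1)^n, and u - 1 lies in F_1 U. *)
Lemma eqU_texp_tlog n u : eqU 1 u 1 -> eqU n (texp n (tlog n (u - 1))) u.
Proof.
move=> u1; have [c ->] := texp_tlog charK0 n (u - 1).
rewrite [1 + _]addrC subrK /eqU addrAC subrr add0r.
by have [] := FU_ideal (FU1_X n u1) c.
Qed.

Lemma tsum_FU1 c n u : FU F i 1 u -> eqU 1 (tsum c n.+1 u) (c 0%N)%:A.
Proof.
move=> u1; rewrite /eqU /tsum big_ord_recl addrAC subrr add0r.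
apply: FU_sum => k _; apply: FUZ; apply: (FUW _ (FU1_X _ u1)); exact: isT.
Qed.

Lemma texp_FU1 n u : FU F i 1 u -> eqU 1 (texp n.+1 u) 1.
Proof. by move=> u1; have := tsum_FU1 (fun k => k`!%:R^-1) n u1; rewrite -texpE invr1 scale1r. Qed.

Lemma tlog_FU1 n u : FU F i 1 u -> FU F i 1 (tlog n.+1 u).
Proof.
move=> u1; have := tsum_FU1 (fun k => (-1) ^+ k.+1 / k%:R) n u1.
by rewrite -tlogE invr0 mulr0 scale0r /eqU subr0.
Qed.

Lemma mul_FU1 u v : eqU 1 u 1 -> eqU 1 v 1 -> eqU 1 (u * v) 1.
Proof. by move=> u1 v1; have := eqUM u1 v1; rewrite mulr1. Qed.

Lemma cR_FU1 u : eqU 1 u 1 -> eqU 1 (cR u) 1.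
Proof. by rewrite -{2}cR1; apply: eqU_cR. Qed.

Lemma i_FU1 x : FU F i 1 (i x).
Proof. exact/FUi/F1. Qed.

Lemma frakRE (y : nat -> A) n : frakR cR y n = tlog n (cR (texp n (y n)) - 1).
Proof. exact: ulogE. Qed.

Lemma frakR_FU1 (y : nat -> A) n : FU F i 1 (y n.+1) -> FU F i 1 (frakR cR y n.+1).
Proof. by move=> y1; rewrite frakRE; apply/tlog_FU1/cR_FU1/texp_FU1. Qed.

Lemma texp_frakR (y : nat -> A) n : FU F i 1 (y n.+1) ->
  eqU n.+1 (texp n.+1 (frakR cR y n.+1)) (cR (texp n.+1 (y n.+1))).
Proof. by move=> y1; rewrite frakRE; apply/eqU_texp_tlog/cR_FU1/texp_FU1. Qed.

Lemma bchE (x y : nat -> A) n : bch x y n = tlog n (texp n (x n) * texp n (y n) - 1).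
Proof. exact: ulogE. Qed.

Lemma bch_FU1 (x y : nat -> A) n : FU F i 1 (x n.+1) -> FU F i 1 (y n.+1) ->
  FU F i 1 (bch x y n.+1).
Proof. by move=> x1 y1; rewrite bchE; apply/tlog_FU1/mul_FU1; apply: texp_FU1. Qed.

Lemma texp_bch (x y : nat -> A) n : FU F i 1 (x n.+1) -> FU F i 1 (y n.+1) ->
  eqU n.+1 (texp n.+1 (bch x y n.+1)) (texp n.+1 (x n.+1) * texp n.+1 (y n.+1)).
Proof. by move=> x1 y1; rewrite bchE; apply/eqU_texp_tlog/mul_FU1; apply: texp_FU1. Qed.

(* The coefficients are the increments of xs, with xs 0 and xs 1 replaced by 0 so that
   the partial sums telescope to xs n. *)
Lemma gseq_series xs : gseq F xs -> exists f : pseries A,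
  [/\ f 0%N = 0, lie_series 0 f & forall n, eqU n (i (xs n)) (eval n f)].
Proof.
move=> xsF; pose ys n := if (n <= 1)%N then 0 else xs n.
exists (Pseries (fun k => i (ys k.+1 - ys k))); split.
- by rewrite /= subrr raddf0.
- move=> k; rewrite addn0; exists (ys k.+1 - ys k) => //.
  case: k => [|[|k]]; rewrite /ys /= ?subrr ?subr0 //; exact: xsF.
move=> n; have -> : eval n (Pseries (fun k => i (ys k.+1 - ys k))) = i (ys n).
  rewrite /eval /= -raddf_sum -(big_mkord xpredT (fun k => ys k.+1 - ys k)).
  by rewrite telescope_sumr // subr0.
(* At level 1 the replacement of xs 1 by 0 is a change within F_1 U. *)
case: n => [//|[|n]]; last exact: eqU_refl.
by rewrite /eqU raddf0 subr0; apply: i_FU1.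
Qed.

(** A lift f of xs is packed with Om = log [cR] (e^f): at t = 1 they give exp x and the value of
    [frakR] at x. *)
Lemma frakR_series xs : gseq F xs -> exists f Om : pseries A,
  [/\ lie_series 0 Om,
      forall n, eqU n.+1 (texp n.+1 (i (xs n.+1))) (eval n.+1 (psexp f)),
      forall n, eqU n.+1 (frakR cR (embed i xs) n.+1) (eval n.+1 Om),
      (ord_ge 1 Om /\ FU_series (psexp f)) &
      forall h, cRs (psexp f * (psexp Om * ps_const h * psexp (- Om)))
              = psexp Om * ps_const (cR h)].
Proof.
move=> /gseq_series [f [f0 fG fE]].
have [Om [Om0 OmG OmE Omlog RB]] := grouplike_series f0 fG.
have f1 : ord_ge 1 f by case.
have Om1 : ord_ge 1 Om by case.
have expE n : eqU n.+1 (texp n.+1 (i (xs n.+1))) (eval n.+1 (psexp f)).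
  pose c k : K := k`!%:R^-1.
  apply: eqU_trans (eqU_tsum c (fE _)) _; apply: (eval_tsum c) => //.
  exact: lie_series_FU.
exists f, Om; split=> //; last by split=> //; apply/FU_series_psum/lie_series_FU.
move=> n; rewrite frakRE.
have g1 : ord_ge 1 (psexp Om - 1).
  by move=> -[|//] _; rewrite psB ps1 [X in X - _]psum_recl big_ord0 addr0 /= invr1 scale1r subrr.
have gF : FU_series (psexp Om - 1).
  move=> k; rewrite psB; apply: FUB; last exact: FU_series1.
  exact/FU_series_psum/lie_series_FU.
(* [Om] is presented as the logarithm of its own exponential, a series in [psexp Om - 1] to which
   [eval_tsum] applies. *)
rewrite Omlog -OmE; 
pose c k : K := (-1) ^+ k.+1 / k%:R; apply: eqU_trans (eval_tsum c n g1 gF).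
apply: (eqU_tsum c); rewrite evalB eval_const OmE eval_cRs.
by apply: eqUD; [apply: eqU_cR | apply: eqU_refl].
Qed.

(** The coefficients of [Om] are i(v_k) with v_k in F_k, so the partial sums of the v_k represent
    the required element. *)
Lemma frakR_in_ghat xs : gseq F xs -> in_ghat F i (frakR cR (embed i xs)).
Proof.
move=> /frakR_series [f [Om [OmG _ RE _ _]]].
have [k|v vE] := @choice nat V (fun k v => (if k is 0 then v = 0 else F k v) /\ Om k = i v).
  by have [v] := OmG k; rewrite addn0 => vk ->; exists v.
exists (fun n => \sum_(k < n) v k); split.
  by case=> [//|m] _; rewrite big_ord_recr /= addrAC subrr add0r; have [] := vE m.+1.
case=> [//|n]; rewrite /embed raddf_sum.
have -> : \sum_(k < n.+1) i (v k) = eval n.+1 Om.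
  by apply: eq_bigr => k _; have [] := vE k.
exact: RE.
Qed.

(* At level n the second argument only enters through the constant series exp (b n). *)
Lemma frakR_rota_baxter xs (b : nat -> A) : gseq F xs -> (forall n, FU F i 1 (b n.+1)) ->
  let x := embed i xs in
  ueq F i (bch (frakR cR x) (frakR cR b))
    (frakR cR (bch (bch (bch x (frakR cR x)) b) (uopp (frakR cR x)))).
Proof.
move=> xsF b1 x [//|n]; rewrite -/(eqU _ _ _).
have [f [Om [OmG expE RE [Om1 EF] RB]]] := frakR_series xsF.
have x1 : FU F i 1 (x n.+1) by apply: i_FU1.
have rx1 : FU F i 1 (frakR cR x n.+1) by apply: frakR_FU1.
have rb1 : FU F i 1 (frakR cR b n.+1) by apply: frakR_FU1.
have nrx1 : FU F i 1 (uopp (frakR cR x) n.+1) by apply: FUN.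
pose c k : K := k`!%:R^-1.
have OmF := lie_series_FU OmG.
have expRE : eqU n.+1 (texp n.+1 (frakR cR x n.+1)) (eval n.+1 (psexp Om)).
  by apply: eqU_trans (eqU_tsum c (RE n)) _; apply: (eval_tsum c).
have NOmF : FU_series (- Om) by move=> k; apply: FUN.
have expNRE : eqU n.+1 (texp n.+1 (uopp (frakR cR x) n.+1)) (eval n.+1 (psexp (- Om))).
  apply: eqU_trans (eqU_tsum c (eqUN (RE n))) _; rewrite -evalN.
  by apply: (eval_tsum c) => // j /Om1 Omj; rewrite psN Omj oppr0.
set h := texp n.+1 (b n.+1).
have constF a : FU_series (ps_const a) by case=> [//|k]; apply: FU0.
have eOmF : FU_series (psexp Om) by apply: (FU_series_psum c).
have eNOmF : FU_series (psexp (- Om)) by apply: (FU_series_psum c).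
(* The two sides are compared before the outer logarithm: each is congruent to the value of
   [psexp Om * ps_const (cR h)]. *)
have lhs : eqU n.+1 (texp n.+1 (frakR cR x n.+1) * texp n.+1 (frakR cR b n.+1))
    (eval n.+1 (psexp Om * ps_const (cR h))).
  apply: (eqU_trans (eqUM expRE (texp_frakR (b1 n)))).
  by rewrite -/h -{1}(eval_const n (cR h)); apply: evalM.
have rhs : eqU n.+1
    (cR (texp n.+1 (bch (bch (bch x (frakR cR x)) b) (uopp (frakR cR x)) n.+1)))
    (eval n.+1 (psexp Om * ps_const (cR h))).
  (* Under [cR], each [bch] is unfolded by cancelling exp against log, leaving the product of four
     exponentials to match at t = 1. *)
  rewrite -RB eval_cRs; apply: eqU_cR.
  have xR1 := bch_FU1 x1 rx1; have xRb1 := bch_FU1 xR1 (b1 n).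
  apply: eqU_trans (texp_bch xRb1 nrx1) _.
  apply: eqU_trans (eqUM (texp_bch xR1 (b1 n)) expNRE) _.
  apply: eqU_trans (eqUM (eqUM (texp_bch x1 rx1) (eqU_refl _ _)) (eqU_refl _ _)) _.
  apply: eqU_trans (eqUM (eqUM (eqUM (expE n) expRE) (eqU_refl _ _)) (eqU_refl _ _)) _.
  rewrite -/h -{1}(eval_const n h) !mulrA.
  apply: eqU_trans (eqUM (eqUM (evalM _ _ _) (eqU_refl _ _)) (eqU_refl _ _)) _ => //.
  apply: eqU_trans (eqUM (evalM _ _ _) (eqU_refl _ _)) _ => //; first exact: FU_seriesM.
  by apply: evalM => //; do ?apply: FU_seriesM.
rewrite bchE [X in eqU _ _ X]frakRE; apply: (eqU_tsum (fun k => (-1) ^+ k.+1 / k%:R)).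
by apply: eqUD; [apply: eqU_trans lhs (eqU_sym rhs) | apply: eqU_refl].
Qed.

End Series.

End Filtration.

(** * Bundling of the linear maps and the final assembly *)

Lemma linear_pack (K : pzRingType) (U W : lmodType K) (f : U -> W) :
  linear f -> exists g : {linear U -> W}, f = g.
Proof. move=> fl; pose g : {linear U -> W} := HB.pack f (GRing.isLinear.Build K U W *:%R f fl).
by exists g.
Qed.

Theorem theorem4p12
  (K : fieldType) (charK0 : [pchar K] =i pred0)
  (V : lmodType K) (br : V -> V -> V) (F : nat -> V -> Prop)
  (R : {linear V -> V})
  (HgRB : filtered_rb_lie br F R)
  (A : algType K) (i : V -> A) (HU : is_UEA br i)
  (cR : A -> A) (HcR : is_calR i R cR) :
  (* frak R maps hat g to hat g and is a Rota-Baxter operator on (hat g, * ) *)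
  (forall xs, gseq F xs -> in_ghat F i (frakR cR (embed i xs))) /\
  (forall xs ys, gseq F xs -> gseq F ys ->
     let x := embed i xs in
     let y := embed i ys in
     ueq F i
       (bch (frakR cR x) (frakR cR y))
       (frakR cR (bch (bch (bch x (frakR cR x)) y) (uopp (frakR cR x))))) /\
  (* complete case: frak R restricts to a map g -> g *)
  (complete_filtration F ->
     forall x : V, exists z : V,
       ueq F i (embed i (fun=> z)) (frakR cR (embed i (fun=> x)))).
Proof.
case: HgRB => _ filtF _ RF.
have [[ilin ibr] _] := HU; have [cRlin cR1 cRi cRM] := HcR.
have [il def_i] := linear_pack ilin; have [cRl def_cR] := linear_pack cRlin.
have A_ind (P : A -> Prop) P1 PL PM := @UEA_ind K V br A i P P1 PL PM HU.
subst i cR.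
have ghat := frakR_in_ghat filtF ibr A_ind RF cR1 cRi cRM charK0.
split; first exact: ghat.
split.
  move=> xs ys xsF ysF.
  apply: (frakR_rota_baxter filtF ibr A_ind RF cR1 cRi cRM charK0 xsF) => n.
  exact: (i_FU1 filtF).
move=> [_ compl] x.
have xF : gseq F (fun=> x) by move=> m m1; rewrite subrr; case: filtF => F0 _ _ _ _; apply: F0.
(* The value of [frakR] at the constant sequence x is represented by a compatible sequence xs, whose
   limit z exists by completeness. *)
have [xs [xsF xsE]] := ghat _ xF.
have [z zE] := compl _ xsF; exists z => -[//|n].
rewrite -(subrKA (il (xs n.+1))); apply: FUD.
  by rewrite -raddfB; apply: (@FUi _ _ _ _ _ n.+1) => //; apply: zE.
by rewrite -opprB; apply: FUN; apply: xsE.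
Qed.
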